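(* Let $p\ge 2$, let $F=f+\psi$ be as in the context, with $p$th derivative of $f$ Lipschitz continuous with constant $L_p$, and suppose $F$ is strongly convex with constant $\sigma_2>0$. Let the inner accuracies $\{\delta_k\}_{k\ge1}$ be chosen according to the rule $$\delta_k := c\cdot\bigl(F(x_{k-2})-F(x_{k-1})\bigr)^{\frac{p+1}{2}},\qquad k\ge 2,$$ with some fixed $c\ge0$, and $\delta_1\ge0$. Then the sequence $\{x_k\}_{k\ge1}$ produced by Monotone Inexact Tensor Method II (described in the context) has the following local superlinear rate of convergence: for all $k\ge1$, $$F(x_{k+1})-F^*\;\le\;\Bigl(\frac{L_p}{p!}\Bigl(\frac{2}{\sigma_2}\Bigr)^{\frac{p+1}{2}}+c\Bigr)\bigl(F(x_{k-1})-F^*\bigr)^{\frac{p+1}{2}}.$$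
   Context: Setting. $\mathbb{E}$ is a finite-dimensional real vector space with dual $\mathbb{E}^*$, and $\langle s,x\rangle$ is the value of $s\in\mathbb{E}^*$ at $x\in\mathbb{E}$. $B:\mathbb{E}\to\mathbb{E}^*$ is a fixed symmetric positive definite linear operator and $\|x\|=\langle Bx,x\rangle^{1/2}$. For a $p$-linear symmetric form, $\|D^pf(x)\|=\max_{\|h_i\|\le 1}D^pf(x)[h_1,\dots,h_p]$; $D^kf(x)[h]^k$ denotes the $k$th directional derivative along $h$ taken $k$ times. Problem: minimize $F(x)=f(x)+\psi(x)$ over $x\in\mathbb{E}$, where $\psi:\mathbb{E}\to\mathbb{R}\cup\{+\infty\}$ is proper closed convex and $f:\operatorname{dom}\psi\to\mathbb{R}$ is convex and (sufficiently many times, at least $p$ times) differentiable. A solution $x^*\in\operatorname{dom}\psi$ is assumed to exist; $F^*=F(x^* )$. Lipschitz assumption: $\|D^pf(x)-D^pf(y)\|\le L_p\|x-y\|$ for all $x,y\in\operatorname{dom}\psi$. Strong convexity with constant $\sigma_2$ (uniform convexity of degree $2$): for all $x,y\in\operatorname{dom}\psi$ and all subgradients $F'(x)\in\partial F(x)$, $$F(y)-F(x)-\langle F'(x),y-x\rangle\;\ge\;\frac{\sigma_2}{2}\|y-x\|^{2}.$$ Model: for $H\ge 0$, $$\Omega_H(x;y)=f(x)+\sum_{k=1}^p\frac1{k!}D^kf(x)[y-x]^k+\frac{H\|y-x\|^{p+1}}{(p+1)!}+\psi(y).$$ Inexact monotone $\delta$-step: $M_{H,\delta}(x)$ denotes any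 point $M\in\operatorname{dom}\psi$ satisfying both $\Omega_H(x;M)-\min_y\Omega_H(x;y)\le\delta$ and $F(M)<F(x)$. Monotone Inexact Tensor Method II: choose $x_0\in\operatorname{dom}\psi$, fix $H:=pL_p$. For $k=0,1,2,\dots$: given $\delta_{k+1}\ge0$, compute $x_{k+1}:=M_{H,\delta_{k+1}}(x_k)$. *)

(* Defs.v *)
From HB Require Import structures.
From mathcomp Require Import all_boot all_order all_fingroup all_algebra.
From mathcomp Require Import all_classical all_reals all_analysis.

Set Implicit Arguments.
Unset Strict Implicit.
Unset Printing Implicit Defensive.

Import Order.TTheory GRing.Theory Num.Theory.
Import numFieldNormedType.Exports.

Local Open Scope classical_set_scope.
Local Open Scope ring_scope.

(* Finite-dimensional normed spaces. *)
#[short(type="normedVectType")]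
HB.structure Definition NormedVector (R : numFieldType) :=
  { E of Vector R E & NormedModule R E }.

(* B : E -> E^* is symmetric positive definite and the norm (hence the topology)
   carried by E is the Euclidean norm induced by B. *)
Record euclidean_norm (R : realType) (E : normedVectType R)
    (B : 'Hom(E, 'Hom(E, R^o))) : Prop := EuclideanNorm {
  eucl_sym : forall x y, B x y = B y x ;
  eucl_pos : forall x, x != 0 -> 0 < B x x ;
  eucl_norm : forall x, `|x| = Num.sqrt (B x x) }.

Definition edom (R : realType) (E : Type) (g : E -> \bar R) : set E :=
  [set x | (g x < +oo)%E].

Definition epigraph (R : realType) (E : Type) (g : E -> \bar R) :
  set (E * R^o) := [set z | (g z.1 <= (z.2)%:E)%E].

Record proper_closed_convex (R : realType) (E : normedVectType R)
    (g : E -> \bar R) : Prop := ProperClosedConvex {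
  pcc_gtNy : forall x, (-oo < g x)%E ;
  pcc_dom : edom g !=set0 ;
  pcc_closed : closed (epigraph g) ;
  pcc_convex : convex_set (epigraph g) }.

Definition multilinear (R : realType) (E : normedVectType R) (k : nat)
    (T : k.-tuple E -> R) : Prop :=
  forall (i : 'I_k) (h : k.-tuple E),
    linear (fun v : E =>
      T [tuple if j == i then v else tnth h j | j < k] : R^o).

Definition symmetric_form (R : realType) (E : normedVectType R) (k : nat)
    (T : k.-tuple E -> R) : Prop :=
  forall (s : 'S_k) (h : k.-tuple E), T [tuple tnth h (s j) | j < k] = T h.

(* Valued in \bar R so that no boundedness has to be known beforehand; for a
   multilinear T the supremum is a finite maximum, and for k >= 1 no absolute
   value is needed around T h. *)
Definition form_norm (R : realType) (E : normedVectType R) (k : nat)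
    (T : k.-tuple E -> R) : \bar R :=
  ereal_sup [set (T h)%:E | h in [set h | forall i, `|tnth h i| <= 1]].

(* f is p times (Frechet) differentiable on A, relatively to A, and D k x is the
   k-th derivative of f at x for x in A and k <= p.  The limits are taken within
   A because A need not be open; f and D are irrelevant outside of A.  As E is
   finite-dimensional, it is enough to differentiate y |-> D k y h for each h. *)
Record derivatives_on (R : realType) (E : normedVectType R) (A : set E)
    (p : nat) (f : E -> R) (D : forall k, E -> k.-tuple E -> R) : Prop :=
  DerivativesOn {
  der0 : forall x, A x -> D 0 x [tuple] = f x ;
  der_multilinear : forall k x, (k <= p)%N -> A x -> multilinear (D k x) ;
  der_symmetric : forall k x, (k <= p)%N -> A x -> symmetric_form (D k x) ;
  derS : forall k x (h : k.-tuple E), (k < p)%N -> A x ->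
    forall eps : R, 0 < eps -> \forall y \near within A (nbhs x),
      `|D k y h - D k x h - D k.+1 x [tuple of y - x :: h]|
        <= eps * `|y - x| }.

Definition lipschitz_derivative (R : realType) (E : normedVectType R)
    (A : set E) (p : nat) (D : forall k, E -> k.-tuple E -> R) (L : R) : Prop :=
  forall x y, A x -> A y ->
    (form_norm (fun h => D p x h - D p y h)%R <= (L * `|x - y|)%:E)%E.

Definition objective (R : realType) (E : Type) (f : E -> R)
    (psi : E -> \bar R) (x : E) : \bar R := ((f x)%:E + psi x)%E.

Definition subdifferential (R : realType) (E : normedVectType R)
    (F : E -> \bar R) (x : E) : set ('Hom(E, R^o)) :=
  [set s | forall y, (F x + (s (y - x))%:E <= F y)%E].

Definition strongly_convex (R : realType) (E : normedVectType R)
    (F : E -> \bar R) (sigma : R) : Prop :=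
  forall x y (s : 'Hom(E, R^o)), edom F x -> edom F y -> subdifferential F x s ->
    ((sigma / 2 * `|y - x| ^+ 2)%:E <= F y - F x - (s (y - x))%:E)%E.

Definition tensor_model (R : realType) (E : normedVectType R) (p : nat)
    (f : E -> R) (D : forall k, E -> k.-tuple E -> R) (psi : E -> \bar R)
    (H : R) (x y : E) : \bar R :=
  ((f x + \sum_(1 <= k < p.+1) (k`!%:R)^-1 * D k x [tuple of nseq k (y - x)]
    + H * `|y - x| ^+ p.+1 / (p.+1)`!%:R)%:E + psi y)%E.

Definition monotone_inexact_step (R : realType) (E : normedVectType R)
    (p : nat) (f : E -> R) (D : forall k, E -> k.-tuple E -> R)
    (psi : E -> \bar R) (H delta : R) (x M : E) : Prop :=
  [/\ edom psi M,
      (tensor_model p f D psi H x M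
         - ereal_inf (range (tensor_model p f D psi H x)) <= delta%:E)%E &
      (objective f psi M < objective f psi x)%E].

Record monotone_inexact_tensor_method (R : realType) (E : normedVectType R)
    (p : nat) (f : E -> R) (D : forall k, E -> k.-tuple E -> R)
    (psi : E -> \bar R) (L : R) (delta : nat -> R) (x : nat -> E) : Prop :=
  MonotoneInexactTensorMethod {
  mitm_init : edom psi (x 0) ;
  mitm_step : forall k,
    monotone_inexact_step p f D psi (p%:R * L) (delta k.+1) (x k) (x k.+1) }.

(* Main.v *)
Require Import Defs.
From mathcomp Require Import all_boot all_order all_fingroup all_algebra.
From mathcomp Require Import all_classical all_reals all_analysis.
From mathcomp Require Import ring lra.

(** The Lipschitz condition bounds the Taylor remainder of [f] at [x_k] by
    [L |y - x_k|^(p+1) / (p+1)!].  Used from above at [x_{k+1}], where the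
    regularization [H = p L >= L] dominates it, and from below at [x^*], it gives
    [F(x_{k+1}) <= F^* + L/p! |x^* - x_k|^(p+1) + delta_{k+1}], because
    [(L + p L)/(p+1)! = L/p!].  Strong convexity at [x^*], with subgradient 0,
    turns the distance into a power of [F(x_k) - F^*], and monotonicity of the
    method replaces [x_k] by [x_{k-1}].  The Taylor bound is obtained on the
    segment by integrating the estimate on the p-th derivative p times. *)

Set Implicit Arguments.
Unset Strict Implicit.
Unset Printing Implicit Defensive.

Import Order.TTheory GRing.Theory Num.Theory.
Import numFieldNormedType.Exports.

Local Open Scope classical_set_scope.
Local Open Scope ring_scope.

Definition has_derivative_within (R : realType) (A : set R) (g dg : R -> R) : Prop :=
  forall t, A t -> forall eps : R, 0 < eps -> \forall s \near t, A s ->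
    `|g s - g t - dg t * (s - t)| <= eps * `|s - t|.

Lemma has_derivative_within_continuous (R : realType) (A : set R) (g dg : R -> R) :
  has_derivative_within A g dg -> {within A, continuous g}.
Proof.
move=> hg; apply/subspace_continuousP => t At.
apply/cvgrPdist_le => e e0.
have K0 : 0 < 1 + `|dg t| by rewrite ltr_pwDl.
have e'0 : 0 < e / (1 + `|dg t|) by rewrite divr_gt0.
near=> s.
have As : A s by near: s; exact: withinT.
have hs : `|g s - g t - dg t * (s - t)| <= 1 * `|s - t|.
  by move: As; near: s; apply: cvg_within; exact: hg.
have st : `|s - t| <= e / (1 + `|dg t|).
  rewrite distrC; near: s; apply: cvg_within.
  exact: (@cvgr_dist_le _ R^o _ _ _ _ _ (@cvg_id _ (nbhs (t : R^o))) _ e'0).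
rewrite distrC -(subrK (dg t * (s - t)) (g s - g t)).
apply: (le_trans (ler_normD _ _)); rewrite normrM.
apply: (le_trans (lerD hs (lexx _))); rewrite -mulrDl mulrC.
by rewrite -ler_pdivlMr.
Unshelve. all: by end_near. Qed.

Lemma has_derivative_within_is_derive (R : realType) (A : set R) (g dg : R -> R) (t : R) :
  has_derivative_within A g dg -> nbhs t A -> is_derive t 1 g (dg t).
Proof.
move=> hg nA.
have At : A t by exact: nbhs_singleton.
have H : h^-1 *: (g (h *: (1:R^o) + t) - g t) @[h --> (0:R^o)^'] --> dg t.
  apply/cvgrPdist_le => e e0.
  near=> h.
  have h0 : h != 0 by near: h; exact: nbhs_dnbhs_neq.
  have : A (t + h) by near: h; apply: nbhs_dnbhs; apply/(@nbhs0P R R^o A).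
  have : A (t + h) -> `|g (t + h) - g t - dg t * (t + h - t)| <= e * `|t + h - t|.
    near: h; apply: nbhs_dnbhs.
    pose P s := A s -> `|g s - g t - dg t * (s - t)| <= e * `|s - t|.
    by apply/(@nbhs0P R R^o P); exact: hg.
  move=> /[apply]; rewrite [t + h]addrC addrK => hgh.
  rewrite [h *: _]mulr1 distrC.
  have -> : h^-1 *: (g (h + t) - g t) - dg t = h^-1 * (g (h + t) - g t - dg t * h).
    by rewrite [RHS]mulrBr [dg t * h]mulrC mulKf.
  by rewrite normrM normfV ler_pdivrMl ?normr_gt0 // [leRHS]mulrC.
apply: DeriveDef; last exact: cvg_lim H.
by apply/cvg_ex; exists (dg t).
Unshelve. all: by end_near. Qed.

Lemma ler_derive_within01 (R : realType) (u du v dv : R -> R) :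
  has_derivative_within [set` `[0, 1]] u du ->
  (forall t : R, is_derive t 1 v (dv t)) ->
  (forall t : R, t \in `[0, 1] -> du t <= dv t) ->
  u 0 <= v 0 -> forall t : R, t \in `[0, 1] -> u t <= v t.
Proof.
move=> hu hv dle uv0 t /[!in_itv]/= /andP[t0 t1].
have sub : `[0, t] `<=` `[0, 1] by apply: subset_itvl; rewrite bnd_simp.
have uvd s : s \in `]0, t[ -> is_derive s 1 (u - v) (du s - dv s).
  move=> st; apply: is_deriveB; apply: has_derivative_within_is_derive hu _.
  apply: filterS (near_in_itvoo st) => r.
  by move/(@subset_itv_oo_cc _ _ _ _ _)/sub.
have uvc : {within `[0, t], continuous (u - v)}.
  move=> s; apply: continuousD _.
    exact: (continuous_subspaceW sub (has_derivative_within_continuous hu)).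
  apply: continuousN; apply: continuous_subspaceT => r.
  exact/differentiable_continuous/derivable1_diffP/(@ex_derive _ _ _ _ _ _ _ (hv r)).
have [r rt] := MVT_segment t0 uvd uvc.
rewrite subr0 -[(u - v) t]/(u t - v t) -[(u - v) 0]/(u 0 - v 0) => e.
have : (du r - dv r) * t <= 0.
  by rewrite mulr_le0_ge0// subr_le0 dle//; exact: sub.
by rewrite -e; move: uv0; lra.
Qed.

(* [a k] stands for [phi k 0] when [k <= p], and [a p.+1] for a one-sided
   Lipschitz constant of [phi p] at 0; bundling them makes the induction shift
   both sequences by one. *)
Lemma taylor_upper_bound (R : realType) (p : nat) (phi : nat -> R -> R) (a : nat -> R) :
  (forall k, (k < p)%N ->
    has_derivative_within [set` `[0, 1]] (phi k) (phi k.+1)) ->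
  (forall k, (k < p)%N -> phi k 0 <= a k) ->
  (forall t : R, t \in `[0, 1] -> phi p t <= a p + a p.+1 * t) ->
  forall t : R, t \in `[0, 1] ->
    phi 0 t <= (\poly_(i < p.+2) (a i / i`!%:R)).[t].
Proof.
elim: p phi a => [|p IHp] phi a hphi hphi0 hphip t t01.
  rewrite horner_poly 2!big_ord_recl big_ord0 /= !fact0.
  by rewrite addr0 expr1 expr0 !divr1 mulr1; exact: hphip.
apply: (@ler_derive_within01 _ _ (phi 1) _
  (horner (\poly_(i < p.+2) (a i.+1 / i`!%:R)))) t01 => //.
- exact: hphi.
- move=> s; apply: trigger_derive; congr (_.[_]); apply/polyP => i.
  rewrite coef_deriv !coef_poly ltnS; case: ltnP => _; last by rewrite mul0rn.
  rewrite factS natrM -mulr_natr; field.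
  by rewrite nat1r !pnatr_eq0 -lt0n fact_gt0.
- move=> s; apply: (IHp (fun k => phi k.+1) (fun k => a k.+1)) => //.
  + by move=> k kp; exact: hphi.
  + by move=> k kp; exact: hphi0.
- rewrite horner_coef0 coef_poly/= fact0 divr1; exact: hphi0.
Qed.

Lemma multilinearZ (R : realType) (E : normedVectType R) (k : nat)
    (T : k.-tuple E -> R) (i : 'I_k) (h : k.-tuple E) (a : R) (v : E) :
  multilinear T ->
  T [tuple if j == i then a *: v else tnth h j | j < k]
    = a * T [tuple if j == i then v else tnth h j | j < k].
Proof.
move=> /(_ i h) Tlin.
have T0 : T [tuple if j == i then 0 else tnth h j | j < k] = 0.
  have := Tlin 1 0 0; rewrite /= scaler0 addr0 scale1r => /eqP.
  by rewrite -subr_eq subrr eq_sym => /eqP.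
by have := Tlin a v 0; rewrite /= T0 !addr0.
Qed.

Lemma multilinear_consZ (R : realType) (E : normedVectType R) (k : nat)
    (T : k.+1.-tuple E -> R) (a : R) (v : E) (h : k.-tuple E) :
  multilinear T -> T [tuple of a *: v :: h] = a * T [tuple of v :: h].
Proof.
have headE w : [tuple of w :: h]
    = [tuple if j == ord0 then w else tnth [tuple of w :: h] j | j < k.+1].
  apply: eq_from_tnth => j; rewrite tnth_mktuple.
  by case: (eqVneq j ord0) => [->|]; rewrite ?tnth0.
have tailE w w' : [tuple if j == ord0 then w else tnth [tuple of w :: h] j | j < k.+1]
    = [tuple if j == ord0 then w else tnth [tuple of w' :: h] j | j < k.+1].
  apply: eq_from_tnth => j; rewrite !tnth_mktuple.
  by case: (unliftP ord0 j) => [i ->|->]; rewrite ?eqxx//= !tnthS.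
by move=> Tlin; rewrite [X in T X]headE (tailE (a *: v) v) multilinearZ// -headE.
Qed.

Lemma multilinear_nseqZ (R : realType) (E : normedVectType R) (k : nat)
    (T : k.-tuple E -> R) (a : R) (v : E) :
  multilinear T ->
  T [tuple of nseq k (a *: v)] = a ^+ k * T [tuple of nseq k v].
Proof.
move=> Tlin.
have step m : (m <= k)%N ->
    T [tuple if (j < m)%N then a *: v else v | j < k] = a ^+ m * T [tuple of nseq k v].
  elim: m => [_|m IHm mk].
    rewrite expr0 mul1r; congr T.
    by apply: eq_from_tnth => j; rewrite tnth_mktuple tnth_nseq.
  rewrite exprS -mulrA -IHm 1?ltnW//.
  set h := [tuple if (j < m)%N then a *: v else v | j < k].
  have := multilinearZ (Ordinal mk) h a v Tlin; congr (T _ = _ * T _).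
    apply: eq_from_tnth => j; rewrite !tnth_mktuple ltnS [in RHS]leq_eqVlt -val_eqE /=.
    by case: eqP.
  apply: eq_from_tnth => j; rewrite !tnth_mktuple -val_eqE /=.
  by case: (altP (nat_of_ord j =P m)) => [->|]; rewrite ?ltnn.
rewrite -(step k)//; congr T; apply: eq_from_tnth => j.
by rewrite tnth_mktuple tnth_nseq ltn_ord.
Qed.

Lemma edom_fineK (R : realType) (E : normedVectType R) (g : E -> \bar R) (x : E) :
  proper_closed_convex g -> edom g x -> (fine (g x))%:E = g x.
Proof. by move=> [gNy _ _ _] gx; rewrite fineK// fin_numE gt_eqF ?gNy// lt_eqF. Qed.

Lemma edom_segment (R : realType) (E : normedVectType R) (g : E -> \bar R)
    (x y : E) (t : R) :
  proper_closed_convex g -> edom g x -> edom g y -> t \in `[0, 1] ->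
  edom g (x + t *: (y - x)).
Proof.
move=> hg gx gy; rewrite in_itv/= => /andP[t0 t1].
have [_ _ _ /(_ (y, fine (g y)) (x, fine (g x)) (Itv01 t0 t1))] := hg.
rewrite !inE /epigraph /= !edom_fineK// => /(_ (lexx _) (lexx _)).
have -> : x + t *: (y - x) = t *: y + (1 - t) *: x.
  by rewrite scalerBr scalerBl scale1r addrCA.
by move=> /le_lt_trans; apply; exact: ltry.
Qed.

Section taylor_form.
Context (R : realType) (E : normedVectType R) (A : set E) (p : nat).
Context (f : E -> R) (D : forall k, E -> k.-tuple E -> R).
Hypothesis derD : derivatives_on A p f D.

Lemma has_derivative_within_segment (k : nat) (x d : E) :
  (k < p)%N -> (forall t : R, t \in `[0, 1] -> A (x + t *: d)) ->
  has_derivative_within [set` `[0, 1]]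
    (fun t => D (x + t *: d) [tuple of nseq k d])
    (fun t => D (x + t *: d) [tuple of nseq k.+1 d]).
Proof.
move=> kp segA t t01 e e0.
have d0 : 0 < 1 + `|d| by rewrite ltr_pwDl.
have cvx : x + s *: d @[s --> t] --> x + t *: d.
  by apply: (cvgD (cvg_cst x)); exact: (@cvgZr_tmp _ _ _ (nbhs t) _ id).
have near_y := derS derD [tuple of nseq k d] kp (segA _ t01) (divr_gt0 e0 d0).
apply: (@filterS _ (nbhs t) _ _ _ _ (cvx _ near_y)) => s /= + s01 => /(_ (segA _ s01)).
have -> : x + s *: d - (x + t *: d) = (s - t) *: d.
  by rewrite opprD addrACA subrr add0r scalerBl.
rewrite multilinear_consZ; last exact: der_multilinear derD _ _ kp (segA _ t01).
have -> : [tuple of d :: [tuple of nseq k d]] = [tuple of nseq k.+1 d].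
  exact: val_inj.
rewrite normrZ [(s - t) * _]mulrC => /le_trans; apply.
rewrite mulrCA [leRHS]mulrC ler_wpM2l// -mulrA ler_piMr//; first exact: ltW.
by rewrite mulrC ler_pdivrMr// mul1r lerDr.
Qed.

Lemma lipschitz_derivative_nseq (L : R) (x y d : E) :
  (0 < p)%N -> lipschitz_derivative A p D L -> A x -> A y ->
  D x [tuple of nseq p d] - D y [tuple of nseq p d] <= L * `|x - y| * `|d| ^+ p.
Proof.
move=> p0 lipD Ax Ay.
have Dlin z : A z -> multilinear (@D p z) by exact: der_multilinear derD _ _ (leqnn p).
have [->|d0] := eqVneq d 0.
  rewrite -(scale0r 0) !multilinear_nseqZ ?scale0r; [|exact: Dlin..].
  by rewrite normr0 expr0n gtn_eqF// !mul0r subrr mulr0.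
have nd0 : 0 < `|d| by rewrite normr_gt0.
pose u := `|d|^-1 *: d.
have -> : D x [tuple of nseq p d] - D y [tuple of nseq p d]
    = D x [tuple of nseq p (`|d| *: u)] - D y [tuple of nseq p (`|d| *: u)].
  by rewrite scalerKV ?lt0r_neq0.
rewrite !(multilinear_nseqZ `|d| u); [|exact: Dlin..].
rewrite -mulrBr [leRHS]mulrC ler_wpM2l ?exprn_ge0// -lee_fin.
apply: le_trans (lipD _ _ Ax Ay); apply: ereal_sup_ubound.
exists [tuple of nseq p u] => // i /=.
by rewrite tnth_nseq normrZ normfV normr_id mulVf ?lt0r_neq0.
Qed.

Hypothesis segA : forall (x y : E) (t : R),
  A x -> A y -> t \in `[0, 1] -> A (x + t *: (y - x)).

Lemma taylor_lipschitz (L : R) (x y : E) :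
  (0 < p)%N -> lipschitz_derivative A p D L -> A x -> A y ->
  `|f y - (f x + \sum_(1 <= k < p.+1) (k`!%:R)^-1 * D x [tuple of nseq k (y - x)])|
    <= L * `|y - x| ^+ p.+1 / (p.+1)`!%:R.
Proof.
move=> p0 lipD Ax Ay; set d := y - x.
pose phi k t := D (x + t *: d) [tuple of nseq k d].
have phi0 k : phi k 0 = D x [tuple of nseq k d] by rewrite /phi scale0r addr0.
have phi00 : phi 0 0 = f x by rewrite phi0 (tuple0 [tuple of nseq 0 d]) (der0 derD).
have phi01 : phi 0 1 = f y.
  by rewrite /phi scale1r addrC subrK (tuple0 [tuple of nseq 0 d]) (der0 derD).
have segd t : t \in `[0, 1] -> A (x + t *: d) by exact: segA.
have dphi k : (k < p)%N -> has_derivative_within [set` `[0, 1]] (phi k) (phi k.+1).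
  by move=> kp; exact: has_derivative_within_segment.
have phip t : t \in `[0, 1] -> `|phi p t - phi p 0| <= L * `|d| ^+ p.+1 * t.
  move=> t01; have t0 : 0 <= t by move: t01; rewrite in_itv => /andP[].
  have eq_norm : `|x + t *: d - x| = t * `|d|.
    by rewrite addrAC subrr add0r normrZ ger0_norm.
  have -> : L * `|d| ^+ p.+1 * t = L * (t * `|d|) * `|d| ^+ p.
    by rewrite exprS; ring.
  rewrite ler_norml lerNl opprB /phi scale0r addr0; apply/andP; split.
    by rewrite -eq_norm distrC; apply: lipschitz_derivative_nseq => //; exact: segd.
  by rewrite -eq_norm; apply: lipschitz_derivative_nseq => //; exact: segd.
set C := L * `|d| ^+ p.+1 in phip *.
have -> : f x + \sum_(1 <= k < p.+1) k`!%:R^-1 * D x [tuple of nseq k d]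
    = \sum_(k < p.+1) phi k 0 / k`!%:R.
  rewrite -(big_mkord xpredT (fun k => phi k 0 / k`!%:R)) big_ltn//.
  rewrite fact0 divr1 phi00; congr (_ + _).
  by apply: eq_bigr => k _; rewrite phi0 mulrC.
pose a (g : nat -> R) k := if k == p.+1 then C else g k.
have aE g k : (k <= p)%N -> a g k = g k by rewrite /a => kp; rewrite ltn_eqF.
have taylor1 g : (\poly_(i < p.+2) (a g i / i`!%:R)).[1]
    = \sum_(k < p.+1) g k / k`!%:R + C / p.+1`!%:R.
  rewrite horner_poly big_ord_recr /= {2}/a eqxx expr1n mulr1; congr (_ + _).
  by apply: eq_bigr => k _; rewrite expr1n mulr1 aE// -ltnS.
have one01 : (1 : R) \in `[0, 1] by rewrite in_itv/= ler01 lexx.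
have aC g : a g p.+1 = C by rewrite /a eqxx.
rewrite ler_norml; apply/andP; split.
  suff : - f y <= - (\sum_(k < p.+1) phi k 0 / k`!%:R) + C / p.+1`!%:R by lra.
  rewrite -sumrN -phi01; under eq_bigr do rewrite -mulNr.
  rewrite -(taylor1 (fun k => - phi k 0)).
  apply: (@taylor_upper_bound R p (fun k t => - phi k t)) one01.
  - move=> k kp t t01 e e0; apply: filterS (dphi k kp t t01 e e0) => s + s01.
    by move=> /(_ s01); rewrite -normrN !opprD !opprK mulNr opprK.
  - by move=> k kp; rewrite aE// ltnW.
  - move=> t t01; rewrite aE// aC.
    have := phip _ t01; rewrite ler_norml => /andP[+ _]; lra.
have := @taylor_upper_bound R p phi (a (fun k => phi k 0)) dphi _ _ 1 one01.
rewrite taylor1 phi01 lerBlDl; apply.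
- by move=> k kp; rewrite aE// ltnW.
- move=> t t01; rewrite aE// aC -lerBlDl.
  exact: le_trans (ler_norm _) (phip _ t01).
Qed.

End taylor_form.

Lemma edom_objectiveE (R : realType) (E : normedVectType R) (f : E -> R)
    (psi : E -> \bar R) (x : E) :
  proper_closed_convex psi -> edom psi x ->
  objective f psi x = (f x + fine (psi x))%:E.
Proof. by move=> hpsi hx; rewrite /objective EFinD edom_fineK. Qed.

Lemma lipschitz_derivative_ge0 (R : realType) (E : normedVectType R) (A : set E)
    (p : nat) (f : E -> R) (D : forall k, E -> k.-tuple E -> R) (L : R) (x y : E) :
  derivatives_on A p f D -> (0 < p)%N -> lipschitz_derivative A p D L ->
  A x -> A y -> x != y -> 0 <= L.
Proof.
move=> derD p0 lipD Ax Ay xy.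
have := lipschitz_derivative_nseq derD (x - y) p0 lipD Ax Ay.
have := lipschitz_derivative_nseq derD (x - y) p0 lipD Ay Ax.
rewrite (distrC y x) -mulrA -exprS => le1 le2.
rewrite -(@pmulr_lge0 _ (`|x - y| ^+ p.+1)) ?exprn_gt0 ?normr_gt0 ?subr_eq0//.
lra.
Qed.

Lemma monotone_inexact_step_le (R : realType) (E : normedVectType R) (p : nat)
    (f : E -> R) (D : forall k, E -> k.-tuple E -> R) (psi : E -> \bar R)
    (L delta : R) (x M z : E) (Fval := fun z => fine (objective f psi z)) :
  (0 < p)%N -> proper_closed_convex psi -> derivatives_on (edom psi) p f D ->
  lipschitz_derivative (edom psi) p D L ->
  monotone_inexact_step p f D psi (p%:R * L) delta x M ->
  edom psi x -> edom psi z ->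
  Fval M <= Fval z + L / p`!%:R * `|z - x| ^+ p.+1 + delta.
Proof.
move=> p0 hpsi derD lipD [hM model_le MltX] hx hz.
have L0 : 0 <= L.
  apply: (lipschitz_derivative_ge0 derD p0 lipD hx hM).
  by apply: contraTneq MltX => ->; rewrite ltxx.
have segA u v t := @edom_segment _ _ psi u v t hpsi.
have tayM := taylor_lipschitz derD segA p0 lipD hx hM.
have tayz := taylor_lipschitz derD segA p0 lipD hx hz.
have FvalE y : edom psi y -> Fval y = f y + fine (psi y).
  by move=> hy; rewrite /Fval edom_objectiveE.
rewrite !FvalE//.
pose m y := f x + \sum_(1 <= k < p.+1) (k`!%:R)^-1 * D k x [tuple of nseq k (y - x)]
    + p%:R * L * `|y - x| ^+ p.+1 / (p.+1)`!%:R + fine (psi y).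
have mE y : edom psi y -> tensor_model p f D psi (p%:R * L) x y = (m y)%:E.
  by move=> hy; rewrite /tensor_model -edom_fineK// -EFinD.
have mM_le : m M <= m z + delta.
  have : (ereal_inf (range (tensor_model p f D psi (p%:R * L) x)) <= (m z)%:E)%E.
    by rewrite -mE//; apply: ereal_inf_lbound; exists z.
  move: model_le; rewrite mE//; case: ereal_inf => [r||]//.
  by rewrite -EFinB !lee_fin; lra.
have HL : L <= p%:R * L by rewrite ler_peMl// ler1n.
have regM : L * `|M - x| ^+ p.+1 / (p.+1)`!%:R
    <= p%:R * L * `|M - x| ^+ p.+1 / (p.+1)`!%:R.
  by rewrite ler_wpM2r// ler_wpM2r.
have regz : L * `|z - x| ^+ p.+1 / (p.+1)`!%:R
      + p%:R * L * `|z - x| ^+ p.+1 / (p.+1)`!%:R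
    = L / p`!%:R * `|z - x| ^+ p.+1.
  rewrite factS natrM; field.
  by rewrite nat1r !pnatr_eq0 -lt0n fact_gt0.
move: mM_le tayM tayz; rewrite /m !ler_norml => ? /andP[_ ?] /andP[? _].
lra.
Qed.

Lemma strongly_convex_growth (R : realType) (E : normedVectType R) (f : E -> R)
    (psi : E -> \bar R) (sigma : R) (xstar x : E)
    (Fval := fun z => fine (objective f psi z)) :
  proper_closed_convex psi -> strongly_convex (objective f psi) sigma ->
  edom psi xstar -> (forall y, (objective f psi xstar <= objective f psi y)%E) ->
  edom psi x -> sigma / 2 * `|x - xstar| ^+ 2 <= Fval x - Fval xstar.
Proof.
move=> hpsi sc hs smin hx.
have := sc xstar x 0; rewrite /Fval {1 2}/edom /= !edom_objectiveE// !ltry.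
rewrite lfunE /= sube0 -EFinB lee_fin; apply=> // y.
by rewrite lfunE /= adde0.
Qed.

Theorem theorem4 (R : realType) (E : normedVectType R)
    (B : 'Hom(E, 'Hom(E, R^o))) (p : nat)
    (f : E -> R) (D : forall k, E -> k.-tuple E -> R) (psi : E -> \bar R)
    (Lp sigma2 c : R) (xstar : E) (delta : nat -> R) (x : nat -> E)
    (F := objective f psi) (Fval := fun z => fine (F z)) :
  (2 <= p)%N ->
  euclidean_norm B ->
  proper_closed_convex psi ->
  convex_function (edom psi) f ->
  derivatives_on (edom psi) p f D ->
  lipschitz_derivative (edom psi) p D Lp ->
  edom psi xstar -> (forall y, (F xstar <= F y)%E) ->
  0 < sigma2 -> strongly_convex F sigma2 ->
  0 <= c -> 0 <= delta 1%N ->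
  (forall k, (2 <= k)%N ->
     delta k = c * (Fval (x (k - 2)%N) - Fval (x (k - 1)%N))
                     `^ ((p%:R + 1) / 2)) ->
  monotone_inexact_tensor_method p f D psi Lp delta x ->
  forall k, (1 <= k)%N ->
    Fval (x k.+1) - Fval xstar
      <= (Lp / p`!%:R * (2 / sigma2) `^ ((p%:R + 1) / 2) + c)
         * (Fval (x (k - 1)%N) - Fval xstar) `^ ((p%:R + 1) / 2).
Proof.
move=> p2 _ hpsi _ derD lipD hs smin sigma0 sc c0 _ deltaE [x0 xstep] [//|k] _.
rewrite subn1 /=.
have p0 : (0 < p)%N by exact: ltnW.
have xdom n : edom psi (x n) by case: n => [//|n]; case: (xstep n).
set q := (p%:R + 1) / 2.
have q0 : 0 <= q by rewrite /q divr_ge0// addr_ge0.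
have [_ _ xlt] := xstep k.
have Lp0 : 0 <= Lp.
  apply: (lipschitz_derivative_ge0 derD p0 lipD (xdom k) (xdom k.+1)).
  by apply: contraTneq xlt => ->; rewrite ltxx.
have Fle : Fval (x k.+1) <= Fval (x k).
  by move: xlt; rewrite /Fval /F !edom_objectiveE// lte_fin => /ltW.
have Fge n : Fval xstar <= Fval (x n).
  by have := smin (x n); rewrite /Fval /F !edom_objectiveE.
have step := monotone_inexact_step_le p0 hpsi derD lipD (xstep k.+1) (xdom k.+1) hs.
rewrite deltaE// subSS subSS subn0 subn1 /= in step.
have growth := strongly_convex_growth hpsi sc hs smin (xdom k.+1).
rewrite -/Fval -/F -/q in step growth.
set G := Fval (x k) - Fval xstar.
have G0 : 0 <= G by rewrite subr_ge0.
have dist_le : `|xstar - x k.+1| ^+ p.+1 <= (2 / sigma2) `^ q * G `^ q.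
  have s0 : 0 <= 2 / sigma2 by rewrite divr_ge0// ltW.
  rewrite -powRM//.
  have -> : `|xstar - x k.+1| ^+ p.+1 = (`|xstar - x k.+1| ^+ 2) `^ q.
    rewrite -!powR_mulrn// -powRrM; congr (_ `^ _).
    by rewrite /q -natr1; field.
  apply: ge0_ler_powR; rewrite ?nnegrE ?exprn_ge0//; first exact: mulr_ge0.
  rewrite distrC.
  rewrite -(ler_pM2l (_ : 0 < sigma2 / 2)) ?divr_gt0//.
  apply: (le_trans growth); rewrite mulrA (_ : _ * (2 / sigma2) = 1) ?mul1r ?lerB//.
  by field; rewrite gt_eqF.
have decr_le : (Fval (x k) - Fval (x k.+1)) `^ q <= G `^ q.
  by apply: ge0_ler_powR; rewrite ?nnegrE ?subr_ge0// lerB.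
have Lpf : 0 <= Lp / p`!%:R by rewrite divr_ge0.
rewrite lerBlDl; apply: (le_trans step); rewrite -addrA lerD2l mulrDl.
apply: lerD; last exact: ler_wpM2l.
by apply: le_trans (ler_wpM2l Lpf dist_le) _; rewrite mulrA.
Qed.
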